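(* The bundle $(C(\mathbb R,\mathbb R)^\omega,\pi,C(\mathbb R,\mathbb R)_{\omega Q_{\mathrm{comp}}})$ of real compactwise extrafunctions has a differentially represented section; that is, there exists a map $r: C(\mathbb R,\mathbb R)_{\omega Q_{\mathrm{comp}}}\to C(\mathbb R,\mathbb R)^\omega$ with $\pi\circ r=\mathrm{id}$ such that for every $F\in C(\mathbb R,\mathbb R)_{\omega Q_{\mathrm{comp}}}$ all the functions in the sequence $r(F)$ are differentiable.
   Context: $C(\mathbb R,\mathbb R)$ is the real vector space of continuous functions $\mathbb R\to\mathbb R$, and $C(\mathbb R,\mathbb R)^\omega$ is the space of all sequences $(f_i)_{i\in\omega}$ of such functions. $Q_{\mathrm{comp}}$ is the set of seminorms $q_{\max[a,b]}(f)=\max\{|f(x)|:x\in[a,b]\}$ for real $a\le b$. For sequences $(f_i),(g_i)$, $(f_i)\approx(g_i)$ means $\lim_{i\to\infty}q(f_i-g_i)=0$ for all $q\in Q_{\mathrm{comp}}$. $C(\mathbb R,\mathbb R)_{\omega Q_{\mathrm{comp}}}$ is the set of equivalence classes (real compactwise extrafunctions), and $\pi$ is the natural projection sending a sequence to its class. The differential operator $\partial=d/dx$ is only partially defined on $C(\mathbb R,\mathbb R)$; ''differentiable'' means belonging to its domain, i.e. being differentiable on $\mathbb R$ with derivative in $C(\mathbb R,\mathbb R)$. A section is a map $r$ with $\pi\circ r=\mathrm{id}$ (no further conditions). *)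

(* Defs.v *)
From HB Require Import structures.
From mathcomp Require Import all_boot all_order all_algebra.
From mathcomp Require Import generic_quotient.
From mathcomp Require Import all_classical all_reals all_analysis.

Set Implicit Arguments.
Unset Strict Implicit.
Unset Printing Implicit Defensive.

Import Order.TTheory GRing.Theory Num.Theory.
Import numFieldNormedType.Exports.

Local Open Scope classical_set_scope.
Local Open Scope ring_scope.
Local Open Scope quotient_scope.

(* The library's [continuousType X Y] carries no algebraic structure; it is
   equipped here with the pointwise vector space operations. *)
Section continuous_lmodType.
Context {K : numFieldType} {X : topologicalType} {V : normedModType K}.
Implicit Types f g h : continuousType X V.

Local Lemma cts_add_proof f g : continuous (fun x => f x + g x).
Proof. by move=> x; apply: continuousD; exact: cts_fun. Qed.

Local Lemma cts_opp_proof f : continuous (fun x => - f x).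
Proof. by move=> x; apply: continuousN; exact: cts_fun. Qed.

Local Lemma cts_scale_proof (k : K) f : continuous (fun x => k *: f x).
Proof. by move=> x; apply: continuousZl_tmp; exact: cts_fun. Qed.

Definition cts_zero : continuousType X V := cst 0.
Definition cts_add f g : continuousType X V := mkcts (@cts_add_proof f g).
Definition cts_opp f : continuousType X V := mkcts (@cts_opp_proof f).
Definition cts_scale k f : continuousType X V := mkcts (@cts_scale_proof k f).

Local Lemma cts_addA : associative cts_add.
Proof. by move=> f g h; apply/continuousEP => x; exact: addrA. Qed.

Local Lemma cts_addC : commutative cts_add.
Proof. by move=> f g; apply/continuousEP => x; exact: addrC. Qed.

Local Lemma cts_add0 : left_id cts_zero cts_add.
Proof. by move=> f; apply/continuousEP => x; exact: add0r. Qed.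

Local Lemma cts_addN : left_inverse cts_zero cts_opp cts_add.
Proof. by move=> f; apply/continuousEP => x; exact: addNr. Qed.

HB.instance Definition _ := GRing.isZmodule.Build (continuousType X V)
  cts_addA cts_addC cts_add0 cts_addN.

Local Lemma cts_scaleA k l f :
  cts_scale k (cts_scale l f) = cts_scale (k * l) f.
Proof. by apply/continuousEP => x; exact: scalerA. Qed.

Local Lemma cts_scale1 : left_id 1 cts_scale.
Proof. by move=> f; apply/continuousEP => x; exact: scale1r. Qed.

Local Lemma cts_scaleDr : right_distributive cts_scale +%R.
Proof. by move=> k f g; apply/continuousEP => x; exact: scalerDr. Qed.

Local Lemma cts_scaleDl f : {morph cts_scale^~ f : k l / k + l}.
Proof. by move=> k l; apply/continuousEP => x; exact: scalerDl. Qed.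

HB.instance Definition _ := GRing.Zmodule_isLmodule.Build K (continuousType X V)
  cts_scaleA cts_scale1 cts_scaleDr cts_scaleDl.

Lemma cts_addE f g x : (f + g) x = f x + g x. Proof. by []. Qed.
Lemma cts_oppE f x : (- f) x = - f x. Proof. by []. Qed.
Lemma cts_subE f g x : (f - g) x = f x - g x. Proof. by []. Qed.
Lemma cts_scaleE k f x : (k *: f) x = k *: f x. Proof. by []. Qed.

End continuous_lmodType.

Section extrafunctions.
Variable R : realType.

Definition Cfun : Type := continuousType R R.

Definition Cseq : Type := nat -> Cfun.

(* [sup] is total; the value is the maximum by [qmax_attained] and [le_qmax]. *)
Definition qmax (a b : R) (f : Cfun) : R :=
  sup [set `|f x| | x in `[a, b]%classic].

Definition Qcomp : set (Cfun -> R) :=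
  [set q | exists a b : R, a <= b /\ q = qmax a b].

Lemma qmax_max (a b : R) (f : Cfun) : a <= b -> exists2 c, c \in `[a, b] &
  forall x : R, x \in `[a, b] -> `|f x| <= `|f c|.
Proof.
move=> ab; apply: (@EVT_max R (fun x => `|f x|)) => //.
apply: continuous_subspaceT => x.
by apply: continuous_comp; [exact: cts_fun | exact: norm_continuous].
Qed.

Lemma le_qmax (a b : R) (f : Cfun) x : x \in `[a, b] ->
  `|f x| <= qmax a b f.
Proof.
move=> xab; have ab : a <= b.
  by move: xab; rewrite in_itv /= => /andP[]; exact: le_trans.
have [c cab fc] := qmax_max f ab.
apply: ub_le_sup; last by exists x.
by exists `|f c| => _ [y yab <-]; exact: fc.
Qed.

Lemma qmax_attained (a b : R) (f : Cfun) : a <= b ->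
  exists2 c, c \in `[a, b] & qmax a b f = `|f c|.
Proof.
move=> ab; have [c cab fc] := qmax_max f ab; exists c => //.
apply/eqP; rewrite eq_le le_qmax // andbT.
apply: ge_sup; first by exists `|f c|, c.
by move=> _ [y yab <-]; exact: fc.
Qed.

Lemma qmax_ge0 (a b : R) (f : Cfun) : a <= b -> 0 <= qmax a b f.
Proof. by move=> /(qmax_attained f)[c _ ->]. Qed.

Lemma qmaxD (a b : R) (f g : Cfun) : a <= b ->
  qmax a b (f + g) <= qmax a b f + qmax a b g.
Proof.
move=> /(qmax_attained (f + g))[c cab ->].
by rewrite (le_trans (ler_normD _ _)) // lerD // le_qmax.
Qed.

Lemma qmaxZ (a b k : R) (f : Cfun) : qmax a b (k *: f) = `|k| * qmax a b f.
Proof.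
have [ab|/negP ab] := boolP (a <= b); last first.
  have e (h : Cfun) : [set `|h x| | x in `[a, b]%classic] = set0.
    apply/seteqP; split => // t [x]; rewrite /= in_itv /= => /andP[ax xb] _.
    by apply: ab; exact: le_trans xb.
  by rewrite /qmax !e sup0 mulr0.
apply/eqP; rewrite eq_le; apply/andP; split.
  have [c cab ->] := qmax_attained (k *: f) ab.
  by rewrite cts_scaleE normrM ler_wpM2l // le_qmax.
have [c cab ->] := qmax_attained f ab.
by rewrite -normrM -[k * f c]/((k *: f) c) le_qmax.
Qed.

Definition cequiv (f g : Cseq) : Prop :=
  forall q, Qcomp q -> q (f i - g i) @[i --> \oo] --> (0 : R).

Lemma cequiv_refl f : cequiv f f.
Proof.
move=> _ [a [b [ab ->]]].
under eq_fun do rewrite subrr -(scale0r 0) qmaxZ normr0 mul0r.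
exact: cvg_cst.
Qed.

Lemma cequiv_sym f g : cequiv f g -> cequiv g f.
Proof.
move=> fg _ [a [b [ab ->]]].
under eq_fun do rewrite -opprB -scaleN1r qmaxZ normrN1 mul1r.
by apply: fg; exists a, b.
Qed.

Lemma cequiv_trans f g h : cequiv f g -> cequiv g h -> cequiv f h.
Proof.
move=> fg gh _ [a [b [ab ->]]]; have Qab : Qcomp (qmax a b) by exists a, b.
apply: (@squeeze_cvgr _ _ _ _ (cst 0)
  (fun i => qmax a b (f i - g i) + qmax a b (g i - h i))).
- near=> i; rewrite qmax_ge0 //=.
  by rewrite -(subrKA (g i)) qmaxD.
- exact: cvg_cst.
- by rewrite -[0]addr0; apply: cvgD; [exact: fg | exact: gh].
Unshelve. all: end_near. Qed.

Definition cequivb (f g : Cseq) : bool := `[< cequiv f g >].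

Lemma cequivb_refl : reflexive cequivb.
Proof. by move=> f; apply/asboolP; exact: cequiv_refl. Qed.

Lemma cequivb_sym : symmetric cequivb.
Proof. by move=> f g; apply/asboolP/asboolP; exact: cequiv_sym. Qed.

Lemma cequivb_trans : transitive cequivb.
Proof.
by move=> g f h /asboolP fg /asboolP gh; apply/asboolP; exact: cequiv_trans fg gh.
Qed.

Canonical extrafun_equiv :=
  EquivRel cequivb cequivb_refl cequivb_sym cequivb_trans.

Definition extrafun : Type := {eq_quot extrafun_equiv}.

Definition extrafun_pi (f : Cseq) : extrafun := \pi_extrafun f.

Lemma extrafun_piP f g : extrafun_pi f = extrafun_pi g <-> cequiv f g.
Proof. by split => [/eqmodP/asboolP | fg]; last exact/eqmodP/asboolP. Qed.

Lemma extrafun_pi_surj (F : extrafun) : exists f, extrafun_pi f = F.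
Proof. by exists (repr F); exact: reprK. Qed.

Definition is_section (r : extrafun -> Cseq) : Prop := extrafun_pi \o r = id.

(* Differentiability on the whole line with derivative again in [Cfun]. *)
Definition ddx_domain : set Cfun :=
  [set f | (forall x : R, derivable f x 1) /\ continuous f^`()%classic].

Definition differentially_represented (r : extrafun -> Cseq) : Prop :=
  forall (F : extrafun) (i : nat), ddx_domain (r F i).

End extrafunctions.

(* Main.v *)
(* On [-n, n], a continuous function is uniformly close to its Steklov mean
   x |-> (F (x + h) - F x) / h, where F is a primitive and h > 0 is small,
   because by the mean value theorem the latter is a value of the function in
   [x, x + h]; and the Steklov mean is C^1.  Replacing the i-th term of a
   representative by a C^1 function within 1/(i+1) of it on [-i, i] does not
   change the class. *)
Require Import Defs.
From mathcomp Require Import all_boot all_order all_algebra.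
From mathcomp Require Import all_classical all_reals all_analysis.
From mathcomp Require Import ring lra.

Import Order.TTheory GRing.Theory Num.Theory.
Import numFieldNormedType.Exports.

Local Open Scope classical_set_scope.
Local Open Scope ring_scope.

Section smooth_approximation.
Context {R : realType}.
Implicit Types (f p F : R -> R) (a b e h x t : R).

(** Continuity gives near each point of [[a, b]] a bound on [h] that serves a whole neighbourhood;
    compactness, in its near-covering form, makes it uniform. Here [t] may exceed [b], so continuity
    beyond the segment matters. *)
Lemma compact_oscillation f a b e : continuous f -> 0 < e ->
  exists2 h, 0 < h & forall x, x \in `[a, b] ->
    forall t, x <= t <= x + h -> `|f x - f t| <= e.
Proof.
move=> cf e0.
have /compact_near_coveringP cov := @segment_compact R a b.
pose P h x := forall t, x <= t <= x + h -> `|f x - f t| <= e.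
have : \forall h \near (0 : R)^'+, `[a, b] `<=` P h.
  apply: cov => x _.
  have e2 : 0 < e / 2 by rewrite divr_gt0.
  have /cvgrPdist_lt/(_ _ e2)[d /= d0 fd] := cf x.
  have d2 : 0 < d / 2 by rewrite divr_gt0.
  (* Halving [d] keeps both [y] and every [t] in [[y, y + h]] within [d] of [x]. *)
  exists (ball x (d / 2), [set h | h < d / 2]) => /=.
    by split; [exact: nbhsx_ballx | exact: nbhs_right_lt].
  move=> [y h] [/= xy hd] t /andP[yt th].
  have fy : `|f x - f y| < e / 2.
    apply: fd => /=; apply: lt_trans xy _; lra.
  have ft : `|f x - f t| < e / 2.
    apply: fd => /=; move: xy; rewrite /ball /= !ltr_norml => /andP[? ?].
    by apply/andP; split; lra.
  rewrite (_ : f y - f t = (f x - f t) - (f x - f y)); last by ring.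
  apply: le_trans (ler_normB _ _) _; lra.
move=> cov'; near (0 : R)^'+ => h; exists h; first by [].
by near: h; apply: filterS cov' => h hP x xab; exact: hP.
Unshelve. all: end_near. Qed.

(** As [p] vanishes left of [a], its integral from minus infinity only sees a bounded interval, so a
    single formula gives a primitive on the whole line. *)
Lemma left_vanishing_primitive p a : continuous p ->
  (forall x, x <= a -> p x = 0) -> exists F, forall x, is_derive x 1 F (p x).
Proof.
move=> cp p0; exists (fun x => \int[lebesgue_measure]_(t in `]-oo, x]) p t)%R => x.
(* The bound [x + 1] leaves [x] interior, as the fundamental theorem requires; cutting [p] off at
   [a] reduces integrability to a compact segment. *)
have ip : lebesgue_measure.-integrable `]-oo, x + 1] (EFin \o p).
  have -> : EFin \o p = (EFin \o p) \_ `[a, +oo[.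
    apply/funext => t; rewrite patchE; case: ifPn => //= /negP ta.
    rewrite p0// leNgt; apply/negP => /ltW at_; apply: ta.
    by rewrite inE /= in_itv /= at_.
  apply/integrable_restrict => //.
  have -> : `]-oo, x + 1] `&` `[a, +oo[ = `[a, x + 1]%classic.
    apply/seteqP; split => t /=; rewrite !in_itv /= ?andbT.
      by move=> [-> ->].
    by move=> /andP[-> ->].
  apply: continuous_compact_integrable; first exact: segment_compact.
  exact: continuous_subspaceT.
have xx1 : x < x + 1 by rewrite ltrDl.
have /= [|dF Fp] := continuous_FTC1 xx1 ip _ (cp x); first by rewrite ltNyr.
by split; rewrite -?derive1E.
Qed.

Lemma primitive_right_of f a : continuous f ->
  exists p, exists2 F, [/\ continuous p & forall x, is_derive x 1 F (p x)] &
    forall x, a <= x -> p x = f x.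
Proof.
(* [ramp] is 0 up to [a - 1], 1 from [a] on, and affine in between: it makes [f] vanish far to the
   left without changing it right of [a]. *)
move=> cf; pose ramp x := (`|x - a + 1| - `|x - a| + 1) / 2.
have cn (c : R) : continuous (fun x => `|x + c|).
  by move=> x; apply: cvg_norm; apply: cvgD; [exact: cvg_id | exact: cvg_cst].
have cp : continuous (fun x => f x * ramp x).
  move=> x; apply: cvgM; first exact: cf.
  apply: cvgM; last exact: cvg_cst.
  apply: cvgD; last exact: cvg_cst.
  apply: cvgB; last exact: cn.
  by under eq_fun do rewrite -addrA; rewrite -addrA; exact: cn.
have p0 x : x <= a - 1 -> f x * ramp x = 0.
  move=> xa; rewrite /ramp !ler0_norm; [by field | lra | lra].
have [F dF] := left_vanishing_primitive _ _ cp p0.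
exists (fun x => f x * ramp x), F => // x ax.
by rewrite /ramp !ger0_norm; [field | lra | lra].
Qed.

Lemma ddx_domain_is_derive (f df : R -> R) (cf : continuous f) :
  (forall x, is_derive x 1 f (df x)) -> continuous df ->
  ddx_domain (mkcts cf).
Proof.
move=> dfE cdf; split=> [x|] /=; first exact: ex_derive.
by rewrite (_ : derive1 f = df) //; apply/funext => x; rewrite derive1E derive_val.
Qed.

Lemma ddx_domain_approx (f : Cfun R) a b e : a <= b -> 0 < e ->
  exists2 g : Cfun R, ddx_domain g & qmax a b (g - f) <= e.
Proof.
move=> ab e0; have cf : continuous f by exact: cts_fun.
have [p [F [cp dF] pf]] := primitive_right_of f a cf.
have [h h0 osc] := compact_oscillation f a b e cf e0.
(* The difference is taken forward: for [x] in [[a, b]] it only involves points right of [a], where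
   [p] agrees with [f]. *)
pose g x := h^-1 * (F (x + h) - F x).
have dg x : is_derive x 1 g (h^-1 * (p (x + h) - p x)).
  have dFh : is_derive x 1 (fun y => F (y + h)) (p (x + h)).
    rewrite -[p _]mulr1; exact: is_derive1_comp (dF _) (is_derive_shift _ _ _).
  exact: is_deriveZ.
have cg : continuous g.
  move=> x; apply: differentiable_continuous; apply/derivable1_diffP.
  exact: ex_derive.
exists (mkcts cg).
  apply: ddx_domain_is_derive dg _ => x.
  apply: cvgM; first exact: cvg_cst.
  apply: cvgB; last exact: cp.
  apply: continuous_comp; last exact: cp.
  by apply: cvgD; [exact: cvg_id | exact: cvg_cst].
have [x xab ->] := qmax_attained ((mkcts cg : Cfun R) - f) ab.
rewrite cts_subE; change (`|g x - f x| <= e).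
have cF : continuous F.
  move=> y; apply: differentiable_continuous; apply/derivable1_diffP.
  exact: ex_derive.
have xxh : x <= x + h by rewrite lerDl ltW.
(* This makes [g x] equal to [p c] with [c] in [[x, x + h]]; since [a <= c], that is [f c], and the
   choice of [h] applies. *)
have [c cx Fc] := MVT_segment xxh (fun y _ => dF y) (continuous_subspaceT cF).
rewrite /g Fc (addrC x h) addrK mulrCA mulVf ?gt_eqF// mulr1 distrC.
move: cx xab (osc x xab c); rewrite !in_itv /= => /andP[xc cxh] /andP[ax xb].
by rewrite pf ?(le_trans ax)//; apply; rewrite xc.
Qed.

End smooth_approximation.

(** A fixed [[a, b]] lies in [[-i, i]] once [i] is at least [|a| + |b|], so its seminorm is
    eventually dominated by the harmonic sequence. *)
Lemma cequiv_of_qmax_le (R : realType) (f g : Cseq R) :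
  (forall i, qmax (- i%:R) i%:R (f i - g i) <= i.+1%:R^-1) -> cequiv f g.
Proof.
move=> fg _ [a [b [ab ->]]].
apply: (@squeeze_cvgr _ _ _ _ (cst 0) (@harmonic R)); last 2 first.
- exact: cvg_cst.
- exact: cvg_harmonic.
near=> i; rewrite qmax_ge0 //=; apply: le_trans (fg i).
have [c + ->] := qmax_attained (f i - g i) ab.
rewrite in_itv /= => /andP[ac cb]; apply: le_qmax; rewrite in_itv /=.
have iab : `|a| + `|b| <= i%:R by near: i; exact: nbhs_infty_ger.
have := ler_norm b; have := ler_norm (- a); rewrite normrN.
have := normr_ge0 a; have := normr_ge0 b; move=> *.
by apply/andP; split; lra.
Unshelve. all: end_near. Qed.

Theorem theorem3p3 (R : realType) :
  exists r : extrafun R -> Cseq R,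
    is_section r /\ differentially_represented r.
Proof.
have approx (i : nat) (f : Cfun R) : exists g : Cfun R,
    ddx_domain g /\ qmax (- i%:R) i%:R (g - f) <= i.+1%:R^-1.
  have [||g dg gf] := @ddx_domain_approx R f (- i%:R) i%:R i.+1%:R^-1.
  - by rewrite ge0_cp.
  - by rewrite invr_gt0.
  - by exists g.
(* [s] is an arbitrary section; [g] then smooths its terms one by one, with a precision set by the
   index. *)
have [s sP] := choice (fun F : extrafun R => extrafun_pi_surj F).
have [g gP] := choice (fun u : nat * Cfun R => approx u.1 u.2).
exists (fun F i => g (i, s F i)); split=> [|F i]; last by have [] := gP (i, s F i).
apply/funext => F /=; rewrite -[RHS]sP; apply/extrafun_piP.
by apply: cequiv_of_qmax_le => i; have [] := gP (i, s F i).
Qed.
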